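(* For all integers $n\ge4$ and $1\le d\le n-2$ and $m\ge d$, the Markov complexity of $m\times n$ integer matrices of rank $d$ may be arbitrarily large: for every positive integer $N$ there exists $A\in\mathbb{Z}^{m\times n}$ of rank $d$ with $m(A)\ge N$.
   Context: For $A\in\mathbb{Z}^{m\times n}$ and $r\ge2$, the $r$-th Lawrence lifting $A^{(r)}$ is the $(rm+n)\times rn$ matrix with $r$ copies of $A$ on the block diagonal and final block row $(I_n\ I_n\ \cdots\ I_n)$. Elements of $\operatorname{Ker}_{\mathbb{Z}}(A^{(r)})$ are identified with $r\times n$ integer matrices whose rows lie in $\operatorname{Ker}_{\mathbb{Z}}(A)$ and sum to zero; the type of such an element is its number of nonzero rows. For an integer matrix $M$ with $N'$ columns, a Markov basis is a finite set $\mathcal{M}\subseteq\operatorname{Ker}_{\mathbb{Z}}(M)$ such that whenever $\mathbf{w},\mathbf{u}\in\mathbb{N}^{N'}$ with $\mathbf{w}-\mathbf{u}\in\operatorname{Ker}_{\mathbb{Z}}(M)$ there exist $\mathbf{v}_1,\ldots,\mathbf{v}_p\in\mathcal{M}\cup(-\mathcal{M})$ with $\mathbf{w}-\sum_{i\le l}\mathbf{v}_i\in\mathbb{N}^{N'}$ for all $l$ and $\mathbf{w}-\mathbf{u}=\sum_{i=1}^p\mathbf{v}_i$; it is minimal if no proper subset is a Markov basis. The universal Markov basis of $M$ is the union of all minimal Markov bases (vectors differing by sign identified). The Markov complexity $m(A)$ is the largest type of any element of the universal Markov basis of $A^{(r)}$, as $r\ge2$ varies. *)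

(* Defs.v *)
From HB Require Import structures.
From mathcomp Require Import all_boot all_order all_algebra.
From mathcomp Require Import finmap.

Set Implicit Arguments.
Unset Strict Implicit.
Unset Printing Implicit Defensive.

Import Order.TTheory GRing.Theory Num.Theory.
Local Open Scope fset_scope.
Local Open Scope ring_scope.

Section MarkovBases.

Variables p q : nat.
Variable M : 'M[int]_(p, q).

(* Natural vectors are the integer column vectors with nonnegative entries.
   The path [vs] may be empty, which is needed when [w = u]. *)
Definition markov_basis (S : {fset 'cV[int]_q}) : Prop :=
  (forall v, v \in S -> M *m v = 0) /\
  (forall w u : 'cV[int]_q,
     w \is a mxOver Num.nneg -> u \is a mxOver Num.nneg ->
     M *m (w - u) = 0 ->
     exists vs : seq 'cV[int]_q,
       [/\ forall v, v \in vs -> v \in S \/ - v \in S,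
           forall l, (l <= size vs)%N ->
             w - \sum_(v <- take l vs) v \is a mxOver Num.nneg
         & w - u = \sum_(v <- vs) v]).

Definition minimal_markov_basis (S : {fset 'cV[int]_q}) : Prop :=
  markov_basis S /\
  (forall S' : {fset 'cV[int]_q}, S' `<` S -> ~ markov_basis S').

(* Negating an element of a minimal Markov basis gives a minimal Markov basis,
   so this union is closed under sign; identifying v with - v does not affect
   the set of types occurring in it. *)
Definition universal_markov_basis (v : 'cV[int]_q) : Prop :=
  exists2 S, minimal_markov_basis S & v \in S.

End MarkovBases.

Definition lawrence (m n : nat) (A : 'M[int]_(m, n)) (r : nat) :
    'M[int]_((\sum_(i < r) m) + n, \sum_(i < r) n) :=
  col_mx (\mxblock_(i < r, j < r) (if i == j then A else 0))
         (\mxrow_(i < r) 1%:M).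

(* The i-th row of the r x n matrix identified with v is the transpose of the
   i-th block of v. *)
Definition lawrence_type (r n : nat) (v : 'cV[int]_(\sum_(i < r) n)) : nat :=
  #|[set i : 'I_r | submxcol v i != 0]|.

Lemma lawrence_kerE (m n r : nat) (A : 'M[int]_(m, n))
    (v : 'cV[int]_(\sum_(i < r) n)) :
  lawrence A r *m v = 0 <->
  (forall i, A *m submxcol v i = 0) /\ \sum_(i < r) submxcol v i = 0.
Proof.
rewrite /lawrence mul_col_mx -{1 2}[v]submxcolK mul_mxblock_mxrow.
rewrite mul_mxrow_mxcol -col_mx0.
under [X in col_mx _ X]eq_bigr do rewrite mul1mx.
have -> : \mxcol_(i < r) (\sum_(j < r) ((if i == j then A else 0) *m submxcol v j))
    = \mxcol_(i < r) (A *m submxcol v i).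
  apply/eq_mxcol => i; rewrite (bigD1 i) //= eqxx big1 ?addr0 // => j.
  by rewrite eq_sym => /negbTE ->; rewrite mul0mx.
split=> [/eq_col_mx[]|[h ->]].
  by rewrite -mxcol0 => /eq_mxcolP.
by congr col_mx; rewrite -mxcol0; apply/eq_mxcol.
Qed.

(* "k is the Markov complexity m(A)": k is the maximum, in particular it is
   attained, of the types of the elements of the universal Markov bases of the
   Lawrence liftings of A. *)
Definition is_markov_complexity (m n : nat) (A : 'M[int]_(m, n)) (k : nat) :
    Prop :=
  (exists (r : nat) (v : 'cV[int]_(\sum_(i < r) n)),
     [/\ (2 <= r)%N, universal_markov_basis (lawrence A r) v
       & lawrence_type v = k]) /\
  (forall (r : nat) (v : 'cV[int]_(\sum_(i < r) n)),
     (2 <= r)%N -> universal_markov_basis (lawrence A r) v ->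
     (lawrence_type v <= k)%N).

(* Main.v *)
Require Import Defs.
From HB Require Import structures.
From mathcomp Require Import all_boot all_order all_algebra.
From mathcomp Require Import finmap zify.
From Stdlib Require Import Classical_Prop.

Set Implicit Arguments.
Unset Strict Implicit.
Unset Printing Implicit Defensive.

Import Order.TTheory GRing.Theory Num.Theory.
Local Open Scope ring_scope.

(* Finiteness of the complexity: an element v of a minimal Markov basis of a
   pointed kernel is primitive for conformal sums, for otherwise moving by the
   two summands one after the other would make v redundant.  Split every row of
   a primitive element v of a Lawrence lifting into pieces from a finite set of
   kernel vectors of A; by Dickson's lemma, the zero-sum multiset of all pieces
   contains a nonempty zero-sum one of bounded size, whose pieces regroup to a
   conformal summand of v, hence to v itself.

   Largeness: for the weights 0, 1, t + 1, t + 2 the quadric xw - yz and the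
   binomials x^t z - y^(t+1), z^(t+1) - y w^t are alone in their fibers, and t
   times the exponent vector of the first one is the difference of the exponent
   vectors of the other two up to sign.  The t + 2 rows of this primitive
   relation form an indispensable element.  Adding a large constant to the
   weights makes a single equation equivalent to homogeneity plus weight on
   these fibers, which covers rank 1; further columns are forced to vanish on
   the fiber, so that they can carry any additional rank. *)

(** * Dickson's lemma *)

(** Induction on the list of functions. A base for [fs] settles all [x] whose [f x] is at least the
    maximum of [f] on it; the other [x] lie in finitely many level sets of [f], each handled by
    induction. *)
Lemma dickson (T : eqType) (fs : seq (T -> nat)) (P : T -> Prop) :
  exists s : seq T, (forall x, x \in s -> P x) /\
    forall x, P x -> exists2 y, y \in s & all (fun f => f y <= f x)%N fs.
Proof.
elim: fs P => [|f fs IH] P.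
  have [[x Px]|nP] := classic (exists x, P x).
    exists [:: x]; split=> [y|y _]; first by rewrite inE => /eqP ->.
    by exists x; rewrite ?inE.
  by exists [::]; split=> // x Px; case: nP; exists x.
have low k : exists s : seq T, (forall x, x \in s -> P x) /\
    forall x, P x -> (f x < k)%N ->
      exists2 y, y \in s & all (fun f => f y <= f x)%N (f :: fs).
  elim: k => [|k [s [sP sD]]]; first by exists [::].
  have [s' [s'P s'D]] := IH (fun x => P x /\ f x = k).
  exists (s ++ s'); split=> [x|x Px].
    by rewrite mem_cat => /orP[/sP|/s'P[]].
  rewrite ltnS leq_eqVlt => /orP[/eqP fx|/sD[//|y ys yx]].
    have [y ys yx] := s'D x (conj Px fx); have [_ fy] := s'P y ys.
    by exists y; rewrite ?mem_cat ?ys ?orbT //= fx fy leqnn.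
  by exists y; rewrite ?mem_cat ?ys.
have [s [sP sD]] := IH P.
have [s' [s'P s'D]] := low (\max_(y <- s) f y).
exists (s ++ s'); split=> [x|x Px]; first by rewrite mem_cat => /orP[/sP|/s'P].
have [fx|fx] := leqP (\max_(y <- s) f y) (f x).
  have [y ys yx] := sD x Px.
  exists y; rewrite ?mem_cat ?ys //= yx andbT.
  exact: leq_trans (leq_bigmax_seq _ ys isT) fx.
have [y ys yx] := s'D x Px fx.
by exists y; rewrite ?mem_cat ?ys ?orbT.
Qed.

(* Restates mxE at type int: the carrier that mxE infers is only convertible
   to int, and lia compares atoms syntactically. *)
Lemma int_addmxE (p q : nat) (u v : 'M[int]_(p, q)) i j :
  (u + v) i j = u i j + v i j.
Proof. by rewrite mxE. Qed.

Lemma int_oppmxE (p q : nat) (u : 'M[int]_(p, q)) i j : (- u) i j = - u i j.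
Proof. by rewrite mxE. Qed.

Lemma int_0mxE (p q : nat) i j : (0 : 'M[int]_(p, q)) i j = 0.
Proof. by rewrite mxE. Qed.

Definition int_mxE := (int_addmxE, int_oppmxE, int_0mxE).

Lemma int_summxE (p q : nat) (I : Type) (r : seq I) (P : pred I)
    (F : I -> 'M[int]_(p, q)) i j :
  (\sum_(x <- r | P x) F x) i j = \sum_(x <- r | P x) F x i j.
Proof. exact: summxE. Qed.

(** * Conformal sums and Graver-type bases *)

Lemma sum_subseq_ge0 (I : eqType) (F : I -> int) (s s' : seq I) :
  (forall x, x \in s -> 0 <= F x) -> subseq s' s ->
  0 <= \sum_(x <- s') F x <= \sum_(x <- s) F x.
Proof.
elim: s s' => [|x s IH] s' s0; first by rewrite subseq0 => /eqP ->; rewrite lexx big_nil.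
have x0 : 0 <= F x by apply: s0; rewrite mem_head.
have {}s0 y : y \in s -> 0 <= F y by move=> ys; apply: s0; rewrite inE ys orbT.
rewrite (big_cons _ _ x); case: s' => [_|y s' /=].
  have /andP[h0 h1] := IH _ s0 (sub0seq s).
  by rewrite h0 (le_trans h1) // lerDr.
case: eqP => [->|_] /IH-/(_ s0)/andP[h0 h1].
  by rewrite big_cons lerD2l h1 addr_ge0.
by rewrite h0 (le_trans h1) // lerDr.
Qed.

Definition conformal (q : nat) (u v : 'cV[int]_q) : Prop :=
  forall i, (0 <= u i 0 <= v i 0) \/ (v i 0 <= u i 0 <= 0).

Section Conformal.

Variable q : nat.
Implicit Types u v w : 'cV[int]_q.

Lemma conformal_trans v u w : conformal u v -> conformal v w -> conformal u w.
Proof. move=> uv vw i; have := uv i; have := vw i; lia. Qed.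

Lemma conformalN u v : conformal u v -> conformal (- u) (- v).
Proof. move=> uv i; have := uv i; rewrite !int_mxE; lia. Qed.

Lemma conformalB u v : conformal u v -> conformal (v - u) v.
Proof. move=> uv i; have := uv i; rewrite !int_mxE; lia. Qed.

(** In each coordinate all summands have the sign of [v], so partial sums stay between zero and the
    full sum. *)
Lemma conformal_subsum (s s' : seq 'cV[int]_q) v :
  (forall g, g \in s -> conformal g v) -> \sum_(g <- s) g = v ->
  subseq s' s -> conformal (\sum_(g <- s') g) v.
Proof.
move=> sv vE ss' i; rewrite -{1 2}vE !int_summxE.
have [v0|v0] := leP 0 (v i 0).
  left; apply: (sum_subseq_ge0 (F := fun g : 'cV[int]_q => g i 0)) => // g /sv/(_ i); lia.
right; have := @sum_subseq_ge0 _ (fun g : 'cV[int]_q => - g i 0) s s'.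
rewrite !sumrN oppr_ge0 lerN2 andbC; apply=> // g /sv/(_ i); lia.
Qed.

Lemma conformal_sum_eq0 (s : seq 'cV[int]_q) v g :
  (forall g, g \in s -> conformal g v) -> \sum_(g <- s) g = 0 ->
  g \in s -> g = 0.
Proof.
move=> sv s0 gs; apply/matrixP => i j; rewrite ord1 int_0mxE.
have /matrixP/(_ i 0) := s0; rewrite int_summxE int_0mxE => si.
have gs1 : subseq [:: g] s by rewrite sub1seq.
apply/eqP; rewrite eq_le; have [v0|v0] := leP 0 (v i 0).
  have := @sum_subseq_ge0 _ (fun g : 'cV[int]_q => g i 0) s _ _ gs1.
  by rewrite big_seq1 si andbC; apply=> h /sv/(_ i); lia.
have := @sum_subseq_ge0 _ (fun g : 'cV[int]_q => - g i 0) s _ _ gs1.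
by rewrite !sumrN si big_seq1 oppr_ge0 lerN2; apply=> h /sv/(_ i); lia.
Qed.

(** The l1 norm, the termination measure for splitting off conformal summands. *)
Definition col_norm v : nat := (\sum_i absz (v i 0%R))%N.

Lemma col_norm_conformalB u v :
  conformal u v -> u != 0 -> (col_norm (v - u) < col_norm v)%N.
Proof.
move=> uv u0.
have [i ui] : exists i, u i 0 != 0.
  apply/existsP; apply: contraNT u0 => /existsPn h.
  by apply/eqP/matrixP => i j; rewrite ord1 mxE; apply/eqP; have := h i; rewrite negbK.
rewrite /col_norm (bigD1 i) // (bigD1 i (F := fun i => absz (v i 0))) //=.
rewrite -addSn leq_add //; first by have := uv i; rewrite !int_mxE; lia.
by apply: leq_sum => j _; have := uv j; rewrite !int_mxE; lia.
Qed.

(** Positive part. Applied to entries and their negatives, it turns the conformal order into a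
    product order on naturals, as Dickson's lemma requires. *)
Definition zpos (z : int) : nat := if z is Posz k then k else 0.

Lemma conformal_zpos u v :
  (forall i, (zpos (u i 0%R) <= zpos (v i 0%R))%N /\
    (zpos (- u i 0%R) <= zpos (- v i 0%R))%N) ->
  conformal u v.
Proof.
move=> h i; have := h i.
by case: (u i 0) => [[|a]|a]; case: (v i 0) => [[|b]|b] //=; rewrite ?NegzE ?opprK /=; lia.
Qed.

Lemma finite_conformal_base (P : 'cV[int]_q -> Prop) :
  exists G : seq 'cV[int]_q, (forall g, g \in G -> P g) /\
    forall v, P v -> exists2 g, g \in G & conformal g v.
Proof.
have [G [GP GD]] := dickson
  ([seq (fun v : 'cV[int]_q => zpos (v i 0)) | i <- enum 'I_q] ++
   [seq (fun v : 'cV[int]_q => zpos (- v i 0)) | i <- enum 'I_q]) P.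
exists G; split=> // v /GD[g gG]; rewrite all_cat => /andP[].
rewrite all_map => /allP h1; rewrite all_map => /allP h2.
exists g => //; apply: conformal_zpos => i.
have ie : i \in enum 'I_q by rewrite mem_enum.
by split; [exact: (h1 i ie)|exact: (h2 i ie)].
Qed.

(** Every nonzero kernel vector has a conformal summand in [G]; subtracting it leaves a conformal
    remainder of smaller norm. *)
Lemma conformal_sum_base p (M : 'M[int]_(p, q)) :
  exists G : seq 'cV[int]_q, (forall g, g \in G -> M *m g = 0 /\ g <> 0) /\
    forall v, M *m v = 0 -> exists s : seq 'cV[int]_q,
      [/\ forall g, g \in s -> g \in G /\ conformal g v
        & \sum_(g <- s) g = v].
Proof.
have [G [GP GD]] := finite_conformal_base (fun v => M *m v = 0 /\ v <> 0).
exists G; split=> // v; have [k] := ubnP (col_norm v).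
elim: k v => // k IH v vk Mv.
have [->|/eqP v0] := eqVneq v 0; first by exists [::]; split; rewrite ?big_nil.
have [g gG gv] := GD v (conj Mv v0).
have [Mg /eqP g0] := GP g gG.
have [||s [sG sv]] := IH (v - g).
- exact: leq_trans (col_norm_conformalB gv g0) vk.
- by rewrite mulmxBr Mv Mg subr0.
exists (g :: s); split=> [h|]; last by rewrite big_cons sv addrC subrK.
rewrite inE => /orP[/eqP -> //|/sG[hG hv]]; split=> //.
exact: conformal_trans hv (conformalB gv).
Qed.

End Conformal.

(** * Walks inside a fiber *)

Definition nneg_col (q : nat) (w : 'cV[int]_q) : Prop := forall i, 0 <= w i 0.

Lemma nneg_colP (q : nat) (w : 'cV[int]_q) :
  w \is a mxOver Num.nneg <-> nneg_col w.
Proof.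
split=> [/mxOverP|] h; last apply/mxOverP; move=> i.
  by have := h i 0.
by move=> j; rewrite ord1 nnegrE; apply: h.
Qed.

Definition pos_col (q : nat) (w : 'cV[int]_q) : 'cV[int]_q :=
  \col_i Num.max (w i 0) 0.

Lemma pos_colE (q : nat) (w : 'cV[int]_q) i :
  pos_col w i 0 = Num.max (w i 0) 0.
Proof. by rewrite mxE. Qed.

(** Inductive form of the paths in the definition of a Markov basis, to be followed move by move;
    [reachP] is the equivalence. *)
Inductive reach (q : nat) (S : {fset 'cV[int]_q}) :
    'cV[int]_q -> 'cV[int]_q -> Prop :=
| reach_refl w : nneg_col w -> reach S w w
| reach_step w x u : nneg_col w -> x \in S \/ - x \in S ->
    reach S (w - x) u -> reach S w u.

Section Reach.

Variables (q : nat) (S : {fset 'cV[int]_q}).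
Implicit Types u v w x y : 'cV[int]_q.

Lemma reachP w u :
  reach S w u <-> exists vs : seq 'cV[int]_q,
    [/\ forall v, v \in vs -> v \in S \/ - v \in S,
        forall l, (l <= size vs)%N ->
          w - \sum_(v <- take l vs) v \is a mxOver Num.nneg
      & w - u = \sum_(v <- vs) v].
Proof.
split.
  elim=> {w u} [w w0|w x u w0 xS _ [vs [vsS vs0 vsE]]].
    exists [::]; split=> //; last by rewrite subrr big_nil.
    by move=> l _; rewrite big_nil subr0; apply/nneg_colP.
  exists (x :: vs); split=> [v||].
  - by rewrite inE => /orP[/eqP ->|/vsS].
  - case=> [|l] /= hl; first by rewrite big_nil subr0; apply/nneg_colP.
    by rewrite big_cons opprD addrA vs0.
  - by rewrite big_cons -vsE [RHS]addrA subrKC.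
move=> [vs]; elim: vs w => [|x vs IH] w [vsS vs0 vsE].
  have -> : u = w by apply/eqP; rewrite eq_sym -subr_eq0 vsE big_nil.
  by apply/reach_refl/nneg_colP; have := vs0 0%N isT; rewrite big_nil subr0.
apply: (@reach_step _ _ _ x).
- by apply/nneg_colP; have := vs0 0%N isT; rewrite big_nil subr0.
- by apply: vsS; rewrite mem_head.
- apply: IH; split=> [v vvs|l hl|]; first by apply: vsS; rewrite inE vvs orbT.
    by have := vs0 l.+1 hl; rewrite /= big_cons opprD addrA.
  by rewrite addrAC vsE big_cons addrC addKr.
Qed.

Lemma reach_nneg_left w u : reach S w u -> nneg_col w.
Proof. by case. Qed.

Lemma reach_trans w x u : reach S w x -> reach S x u -> reach S w u.
Proof. by elim=> // {}w y {}x w0 yS _ IH /IH; apply: reach_step. Qed.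

Lemma reach_add b w u : nneg_col b -> reach S w u -> reach S (w + b) (u + b).
Proof.
move=> b0; have addb x : nneg_col x -> nneg_col (x + b).
  by move=> x0 i; rewrite int_mxE addr_ge0.
elim=> {w u} [w w0|w x u w0 xS _ IH]; first exact/reach_refl/addb.
by apply: (reach_step (addb _ w0) xS); rewrite addrAC.
Qed.

End Reach.

(** * Markov bases: existence, indispensability, primitivity *)

Section MarkovTheory.

Variables (p q : nat) (M : 'M[int]_(p, q)).
Implicit Types u v w x y : 'cV[int]_q.

Lemma markov_basisE (S : {fset 'cV[int]_q}) :
  markov_basis M S <->
  (forall v, v \in S -> M *m v = 0) /\
  (forall w u, nneg_col w -> nneg_col u -> M *m (w - u) = 0 -> reach S w u).
Proof.
split=> -[SM h]; split=> // w u w0 u0 /h hwu.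
  by apply/reachP/hwu; apply/nneg_colP.
by apply/reachP/hwu; apply/nneg_colP.
Qed.

(** Along a conformal decomposition of [w - u] the walk stays entrywise between [w] and [u]. *)
Lemma exists_markov_basis : exists S, markov_basis M S.
Proof.
have [G [GM GD]] := conformal_sum_base M.
exists [fset x in G]%fset; apply/markov_basisE; split=> [v|w u w0 u0 /GD[s [sG sE]]].
  by rewrite inE => /GM[].
apply/reachP; exists s; split=> // [v /sG[vG _]|l _]; first by left; rewrite inE.
have /(_ (take l s)) := conformal_subsum (fun g gs => (sG g gs).2) sE.
move=> /(_ (take_subseq _ _)) cs; apply/nneg_colP => i.
by have := cs i; have := w0 i; have := u0 i; rewrite !int_mxE; lia.
Qed.

Lemma exists_minimal_markov_basis : exists S, minimal_markov_basis M S.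
Proof.
have [S SM] := exists_markov_basis.
have [k] := ubnP #|` S|%fset; elim: k S SM => // k IH S SM Sk.
have [[S' [S'S S'M]]|nS] :=
    classic (exists S', (S' `<` S)%fset /\ markov_basis M S').
  by apply: (IH S' S'M); apply: leq_trans (fproper_ltn_card S'S) _.
by exists S; split=> // S' S'S S'M; apply: nS; exists S'.
Qed.

(** In a two-element fiber the first nonzero move of a path from [w] must lead to [u]; zero moves
    are skipped by induction. *)
Lemma indispensable_in_markov_basis (S : {fset 'cV[int]_q}) w u :
  markov_basis M S -> nneg_col w -> nneg_col u -> w <> u ->
  M *m (w - u) = 0 ->
  (forall x, nneg_col x -> M *m (w - x) = 0 -> x = w \/ x = u) ->
  w - u \in S \/ u - w \in S.
Proof.
move=> /markov_basisE[SM SR] w0 u0 wu Mwu fib.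
suff step x y : reach S x y -> x = w -> y = u -> w - u \in S \/ u - w \in S.
  exact: step (SR w u w0 u0 Mwu) erefl erefl.
elim=> {x y} [x _ ->|x s y _ sS r IH xw yu]; first by [].
rewrite xw in r IH.
have Ms : M *m s = 0.
  by case: sS => /SM //; rewrite mulmxN => /eqP; rewrite oppr_eq0 => /eqP.
have [||E|E] := fib (w - s); first exact: reach_nneg_left r.
- by rewrite subKr.
- exact: IH.
- have -> : u - w = - s by rewrite -E addrAC subrr add0r.
  by rewrite -E subKr.
Qed.

Hypothesis pointed : forall x, M *m x = 0 -> nneg_col x -> x = 0.

(** Otherwise each move by [v] or [- v] could be replaced by walks for two proper summands, and [v]
    deleted from [S]. Pointedness makes distinct points of a fiber incomparable. *)
Lemma minimal_markov_primitive (S : {fset 'cV[int]_q}) v u :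
  minimal_markov_basis M S -> v \in S -> M *m u = 0 -> conformal u v ->
  u = 0 \/ u = v.
Proof.
move=> [/markov_basisE[SM SR] Smin] vS Mu uv.
have [u0|/eqP u0] := eqVneq u 0; first by left.
have [uv'|/eqP uv'] := eqVneq u v; first by right.
case: (Smin (S `\ v)%fset); first exact: fproperD1.
have inS' x : x \in S \/ - x \in S -> x <> v -> x <> - v ->
    x \in (S `\ v)%fset \/ - x \in (S `\ v)%fset.
  move=> [xS|xS] xv xNv; [left|right]; rewrite !inE xS andbT; apply/eqP => //.
  by move=> E; apply: xNv; rewrite -E opprK.
(* A path between the two parts of a proper conformal summand a of z = v or
   z = - v never moves by v, as its points would then dominate a part of z. *)
have part z a w : z = v \/ z = - v -> M *m a = 0 -> conformal a z -> a <> z ->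
    nneg_col w -> nneg_col (w - a) -> reach (S `\ v)%fset w (w - a).
  move=> zv Ma az a_z w0 wa0.
  have Mz : M *m z = 0 by case: zv => ->; rewrite ?mulmxN SM ?oppr0.
  (* [a1] and [a1 - a] are the positive and negative parts of [a]. A walk between them is translated
     by [w - a1], nonnegative because [w] and [w - a] are. *)
  pose a1 := pos_col a.
  have -> : w - a = (a1 - a) + (w - a1) by rewrite [RHS]addrC addrA subrK.
  have {1}-> : w = a1 + (w - a1) by rewrite subrKC.
  apply: reach_add.
    by move=> i; have := wa0 i; have := w0 i; rewrite !int_mxE pos_colE; lia.
  (* If [x - z] is nonnegative, [x] dominates the positive part of [z], hence [a1], and equals [a1]
     by pointedness; then [a] dominates [z], so [a = z]. The case of [x + z] is symmetric, with
     negative parts. *)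
  have fibz x : nneg_col x -> M *m (x - a1) = 0 ->
      nneg_col (x - z) \/ nneg_col (x + z) -> False.
    move=> x0 Mx [xz|xz].
      have xE : x - a1 = 0.
        apply: pointed => // i; have := xz i; have := x0 i; have := az i.
        by rewrite !int_mxE pos_colE; lia.
      apply: a_z; apply/eqP; rewrite -subr_eq0; apply/eqP; apply: pointed.
        by rewrite mulmxBr Ma Mz subr0.
      move=> i; have /matrixP/(_ i 0) := xE; have := xz i; have := az i.
      by rewrite !int_mxE pos_colE; lia.
    have xE : x - a1 + a = 0.
      apply: pointed; first by rewrite mulmxDr Mx Ma addr0.
      move=> i; have := xz i; have := x0 i; have := az i.
      by rewrite !int_mxE pos_colE; lia.
    apply: a_z; apply/eqP; rewrite eq_sym -subr_eq0; apply/eqP; apply: pointed.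
      by rewrite mulmxBr Ma Mz subr0.
    move=> i; have /matrixP/(_ i 0) := xE; have := xz i; have := az i.
    by rewrite !int_mxE pos_colE; lia.
  have r : reach S a1 (a1 - a).
    by apply: SR => [i|i|]; rewrite ?int_mxE ?pos_colE ?subKr //; lia.
  suff avoid x y :
      reach S x y -> M *m (x - a1) = 0 -> reach (S `\ v)%fset x y.
    by apply: avoid r _; rewrite subrr mulmx0.
  move=> {r}.
  elim=> {x y} [x x0 _|x s y x0 sS r IH Mx]; first exact: reach_refl.
  have xs0 := reach_nneg_left r.
  have Ms : M *m s = 0.
    by case: sS => /SM //; rewrite mulmxN => /eqP; rewrite oppr_eq0 => /eqP.
  have sz : s <> z.
    by move=> E; rewrite E in xs0; apply: (fibz x) => //; left.
  have sNz : s <> - z.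
    by move=> E; rewrite E opprK in xs0; apply: (fibz x) => //; right.
  apply: (reach_step x0); last by apply: IH; rewrite addrAC mulmxBr Mx Ms subr0.
  by apply: inS' => // E; case: zv => zv; [apply: sz|apply: sNz|apply: sNz|apply: sz];
    rewrite zv ?opprK.
(* Move by [a], then by [z - a]; both are proper summands since [a] is neither [z] nor zero. *)
have whole z a w : z = v \/ z = - v -> M *m a = 0 -> conformal a z -> a <> z ->
    a <> 0 -> nneg_col w -> nneg_col (w - z) -> reach (S `\ v)%fset w (w - z).
  move=> zv Ma az a_z a0 w0 wz0.
  have Mz : M *m z = 0 by case: zv => ->; rewrite ?mulmxN SM ?oppr0.
  have wa0 : nneg_col (w - a).
    by move=> i; have := w0 i; have := wz0 i; have := az i; rewrite !int_mxE; lia.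
  have E : w - z = (w - a) - (z - a) by rewrite opprB addrA subrK.
  apply: reach_trans (part z a w zv Ma az a_z w0 wa0) _.
  rewrite E; apply: (part z) => //; first by rewrite mulmxBr Mz Ma subr0.
  - exact: conformalB.
  - by move=> E'; apply: a0; rewrite -[a](subKr z) E' subrr.
  - by rewrite -E.
apply/markov_basisE; split=> [x|w x w0 x0 Mwx].
  by rewrite !inE => /andP[_ /SM].
elim: (SR w x w0 x0 Mwx) => {w x w0 x0 Mwx} [w w0|w s x w0 sS r IH].
  exact: reach_refl.
have ws0 := reach_nneg_left r.
have [sv|/eqP sv] := eqVneq s v.
  apply: reach_trans IH; rewrite sv in ws0 *.
  by apply: (whole v u) => //; left.
have [sv'|/eqP sv'] := eqVneq s (- v).
  apply: reach_trans IH; rewrite sv' in ws0 *.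
  apply: (whole (- v) (- u)) => //; [by right| | exact: conformalN | |].
  - by rewrite mulmxN Mu oppr0.
  - by move/oppr_inj.
  - by move/eqP; rewrite oppr_eq0 => /eqP.
by apply: (reach_step w0) IH; apply: inS'.
Qed.

End MarkovTheory.

(** * Lawrence liftings and their bounded Graver complexity *)

Section Lawrence.

Variables (m n : nat) (A : 'M[int]_(m, n)).

Lemma col_blocks_entry (r : nat) (v : 'cV[int]_(\sum_(i < r) n)) k :
  v k 0 = submxcol v (tagnat.sig1 k) (tagnat.sig2 k) 0.
Proof. by rewrite mxE tagnat.sig2K. Qed.

Lemma nneg_col_blocks (r : nat) (v : 'cV[int]_(\sum_(i < r) n)) :
  nneg_col v <-> forall i, nneg_col (submxcol v i).
Proof.
split=> [v0 i j|v0 k]; last by rewrite col_blocks_entry; apply: v0.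
by rewrite mxE; apply: v0.
Qed.

Lemma conformal_blocks (r : nat) (u v : 'cV[int]_(\sum_(i < r) n)) :
  (forall i, conformal (submxcol u i) (submxcol v i)) -> conformal u v.
Proof. by move=> uv k; rewrite !col_blocks_entry; apply: uv. Qed.

Lemma sum_nneg_col_eq0 (I : finType) (F : I -> 'cV[int]_n) j :
  (forall i, 0 <= F i j 0) -> (\sum_i F i) j 0 = 0 -> forall i, F i j 0 = 0.
Proof.
move=> F0; rewrite int_summxE => /eqP; rewrite psumr_eq0 // => /allP h i.
by apply/eqP/(h i); rewrite mem_index_enum.
Qed.

Lemma lawrence_pointed (r : nat) (v : 'cV[int]_(\sum_(i < r) n)) :
  lawrence A r *m v = 0 -> nneg_col v -> v = 0.
Proof.
move=> /lawrence_kerE[_ sv] /nneg_col_blocks v0; apply/mxcolP => i.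
rewrite submxcol0; apply/matrixP => j k; rewrite ord1 [RHS]mxE.
apply: (sum_nneg_col_eq0 (F := fun i => submxcol v i)) => [i'|].
  exact: v0.
by rewrite sv int_mxE.
Qed.

(** The bound is uniform in [r] because [B] consists of multisets of pieces from [G], without
    reference to rows. *)
Lemma graver_complexity_bounded : exists K : nat, forall r
    (v : 'cV[int]_(\sum_(i < r) n)), lawrence A r *m v = 0 ->
    (forall u, lawrence A r *m u = 0 -> conformal u v -> u = 0 \/ u = v) ->
  (lawrence_type v <= K)%N.
Proof.
have [G [GA GD]] := conformal_sum_base A.
have [B [BP BD]] := dickson [seq count_mem g | g <- G] (fun s =>
  [/\ forall g, g \in s -> g \in G, \sum_(g <- s) g = 0 & s <> [::]]).
exists (\max_(s <- B) size s) => r v /lawrence_kerE[Av sv] vprim.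
have [v0|/eqP v0] := eqVneq v 0.
  by rewrite /lawrence_type eq_card0 // => i; rewrite inE v0 submxcol0 eqxx.
have rowD (i : 'I_r) : exists D : seq 'cV[int]_n,
    (forall g, g \in D -> g \in G /\ conformal g (submxcol v i)) /\
    \sum_(g <- D) g = submxcol v i.
  by have [s []] := GD _ (Av i); exists s.
have [D DP] := fin_all_exists rowD.
(* Each piece carries its row index, so that a selection of pieces can be regrouped into rows. *)
pose T := [seq (i, g) | i <- enum 'I_r, g <- D i].
have TD x : x \in T -> x.2 \in D x.1.
  by case/allpairsPdep => i [g [_ gD ->]].
have Ti i : [seq x.2 | x <- T & x.1 == i] = D i.
  suff Te (e : seq 'I_r) : uniq e ->
      [seq x.2 | x <- [seq (j, g) | j <- e, g <- D j] & x.1 == i] =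
      if i \in e then D i else [::].
    by rewrite Te ?enum_uniq // mem_enum.
  elim: e => //= j e IH /andP[je /IH {}IH]; rewrite filter_cat map_cat IH filter_map.
  rewrite -map_comp map_id (@eq_filter _ _ (fun=> j == i)) // inE eq_sym.
  case: (eqVneq j i) => [<-|_] /=; last by rewrite filter_pred0.
  by rewrite (negbTE je) filter_predT cats0.
have sumT : \sum_(x <- T) x.2 = 0.
  rewrite big_allpairs_dep /= big_enum /= -[RHS]sv.
  by apply: eq_bigr => i _; have [_] := DP i.
have [|s sB sT] := BD [seq x.2 | x <- T].
  split=> [g /mapP[x /TD xD ->]||].
  - by have [/(_ _ xD)[]] := DP x.1.
  - by rewrite big_map.
  - move=> T0; apply: v0; apply/mxcolP => i; rewrite submxcol0.
    have [_ <-] := DP i; rewrite -Ti.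
    by case: (T) T0 => //; rewrite big_nil.
have [sG s0 sn0] := BP s sB.
(* No element of [G] occurs more often in [s] than among the pieces, so [s] is found there up to
   order; [U] then restores the row indices. *)
have [t tT st] : exists2 t, subseq t [seq x.2 | x <- T] & perm_eq s t.
  apply/count_subseqP => g; have [gG|gG] := boolP (g \in G).
    by move: sT; rewrite all_map => /allP/(_ g gG).
  by rewrite (count_memPn _) //; apply: contra gG => /sG.
have [U UT Ut] : exists2 U, subseq U T & t = [seq x.2 | x <- U].
  have /subseqP[b _ ->] := tT.
  by exists (mask b T); rewrite ?mask_subseq ?map_mask.
pose u : 'cV[int]_(\sum_(i < r) n) := \mxcol_i \sum_(x <- U | x.1 == i) x.2.
have ui i : submxcol u i = \sum_(g <- [seq x.2 | x <- U & x.1 == i]) g.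
  by rewrite mxcolK big_map big_filter.
have Ui i : subseq [seq x.2 | x <- U & x.1 == i] (D i).
  rewrite -Ti; apply: map_subseq; rewrite subseq_filter filter_all.
  exact: subseq_trans (filter_subseq _ _) UT.
have uv : conformal u v.
  apply: conformal_blocks => i; rewrite ui.
  have [Dv Ds] := DP i.
  by apply: (conformal_subsum _ Ds (Ui i)) => g /Dv[].
have Ux x : x \in U -> x.2 \in D x.1 by move=> /(mem_subseq UT)/TD.
have [|u0|<-] := vprim u _ uv.
- apply/lawrence_kerE; split=> [i|].
    rewrite ui mulmx_sumr big1_seq // => g /= /(mem_subseq (Ui i)) gD.
    by have [/(_ g gD)[/GA[]]] := DP i.
  under eq_bigr do rewrite mxcolK.
  transitivity (\sum_(x <- U) x.2).
    by rewrite [RHS](partition_big (fun x : 'I_r * 'cV[int]_n => x.1) predT).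
  by rewrite -(big_map snd xpredT id) -Ut -(perm_big _ st).
(* The pieces are nonzero and do not cancel within a row, so a row that meets [U] has nonzero
   sum. *)
- have [x xU] : exists x, x \in U.
    case: (U) Ut => [|x U' _]; last by exists x; rewrite mem_head.
    by move=> Ut; move: st sn0; rewrite Ut => /perm_nilP ->.
  have [Dv _] := DP x.1; have [xG _] := Dv _ (Ux x xU).
  case: (GA _ xG) => _ []; move: (ui x.1); rewrite u0 submxcol0 => /esym Ux0.
  apply: (conformal_sum_eq0 (v := submxcol v x.1) _ Ux0).
    by move=> g /(mem_subseq (Ui _))/Dv[].
  by apply/mapP; exists x; rewrite // mem_filter eqxx.
(* Every nonzero row contains at least one of the [size s] selected pieces. *)
apply: leq_trans (leq_bigmax_seq _ sB isT); rewrite (perm_size st) Ut size_map.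
apply: (@leq_trans #|[set i in unzip1 U]|).
  apply/subset_leq_card/subsetP => i; rewrite !inE; apply: contraR => iU.
  rewrite ui (_ : [seq x <- U | _] = [::]) ?big_nil //.
  apply/eqP; rewrite -(negbK (_ == _)) -has_filter; apply: contra iU.
  by case/hasP => x xU /eqP <-; apply: map_f.
by rewrite cardsE (leq_trans (card_size _)) // size_map.
Qed.

End Lawrence.

(** * Existence of the Markov complexity *)

Lemma exists_max_nat (Q : nat -> Prop) (K t : nat) :
  Q t -> (forall k, Q k -> (k <= K)%N) ->
  exists k, [/\ Q k, (t <= k)%N & forall k', Q k' -> (k' <= k)%N].
Proof.
move=> Qt QK; have [j] := ubnP (K - t)%N.
elim: j t Qt => // j IH t Qt tj.
have [[t' [Qt' tt']]|nQ] := classic (exists t', Q t' /\ (t < t')%N).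
  have [|k [Qk t'k kmax]] := IH t' Qt'; first by have := QK _ Qt'; lia.
  by exists k; split=> //; lia.
exists t; split=> // k' Qk'; rewrite leqNgt; apply/negP => tk'.
by apply: nQ; exists k'.
Qed.

Lemma exists_markov_complexity (m n r : nat) (A : 'M[int]_(m, n))
    (v : 'cV[int]_(\sum_(i < r) n)) :
  (2 <= r)%N -> universal_markov_basis (lawrence A r) v ->
  exists2 k, is_markov_complexity A k & (lawrence_type v <= k)%N.
Proof.
move=> r2 vU; have [K KP] := graver_complexity_bounded A.
pose Q k := exists (r : nat) (v : 'cV[int]_(\sum_(i < r) n)),
  [/\ (2 <= r)%N, universal_markov_basis (lawrence A r) v & lawrence_type v = k].
have [||k [Qk vk kmax]] := @exists_max_nat Q K (lawrence_type v).
- by exists r, v.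
- move=> _ [r' [v' [r'2 [S Smin v'S] <-]]]; apply: KP.
    by have [[/(_ _ v'S)]] := Smin.
  move=> u Mu; apply: minimal_markov_primitive Smin v'S Mu.
  exact: lawrence_pointed.
exists k => //; split=> // r' v' r'2 v'U; apply: kmax.
by exists r', v'.
Qed.

(** * Three binomials alone in their fibers *)

Section Example.

Variable t : nat.
Hypothesis t_gt0 : (0 < t)%N.

(** One more than the largest unshifted weight in degree at most t + 1, so that unshifted weight
    cannot make up for a missing unit of degree. *)
Definition shift : nat := (t.+1 * t.+2).+1.

Definition weight (l : seq nat) : nat :=
  (shift * nth 0 l 0 + shift.+1 * nth 0 l 1 +
   (shift + t.+1) * nth 0 l 2 + (shift + t.+2) * nth 0 l 3)%N.

(** Exponents of x, y, z, w. The pairs [row_pos], [row_neg] are yz, xw (t times), then x^t z,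
    y^(t+1), then y w^t, z^(t+1), oriented so that the t + 2 differences sum to zero. *)
Definition row_pos (i : nat) : seq nat :=
  if (i < t)%N then [:: 0; 1; 1; 0]%N
  else if i == t then [:: t; 0; 1; 0]%N else [:: 0; 1; 0; t]%N.

Definition row_neg (i : nat) : seq nat :=
  if (i < t)%N then [:: 1; 0; 0; 1]%N
  else if i == t then [:: 0; t.+1; 0; 0]%N else [:: 0; 0; t.+1; 0]%N.

(* The shift separates the total degree from the weight of a monomial for the
   exponents 0, 1, t + 1, t + 2. *)
Lemma weight_degree (p q s u p' q' s' u' : nat) :
  weight [:: p; q; s; u] = weight [:: p'; q'; s'; u'] ->
  (p' + q' + s' + u' <= t.+1)%N ->
  (p + q + s + u = p' + q' + s' + u')%N /\
  (q + t.+1 * s + t.+2 * u = q' + t.+1 * s' + t.+2 * u')%N.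
Proof.
rewrite /weight /= => E D'.
have {}E : (shift * (p + q + s + u) + (q + t.+1 * s + t.+2 * u) =
    shift * (p' + q' + s' + u') + (q' + t.+1 * s' + t.+2 * u'))%N by lia.
have W : (q + t.+1 * s + t.+2 * u <= t.+2 * (p + q + s + u))%N by nia.
have W' : (q' + t.+1 * s' + t.+2 * u' <= t.+2 * (p' + q' + s' + u'))%N by nia.
move: E W W' D'; rewrite /shift.
move: (p + q + s + u)%N (p' + q' + s' + u')%N (q + _ + _)%N (q' + _ + _)%N.
move=> D D' w w' E W W' Dt.
have DD : D = D'.
  by case: (ltngtP D D') => // h; nia.
by rewrite DD in E *; lia.
Qed.

(** Degree and unshifted weight are fixed by [weight_degree]; bounding the exponents of the heavy
    variables leaves two monomials. *)
Lemma row_fiber (i p q s u : nat) :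
  weight [:: p; q; s; u] = weight (row_pos i) ->
  [:: p; q; s; u] = row_pos i \/ [:: p; q; s; u] = row_neg i.
Proof.
rewrite /row_pos /row_neg; case: ifP => _; last case: ifP => _.
- move=> /weight_degree[]; first by lia.
  move=> D W.
  have [u0|[u1|u2]] : u = 0%N \/ u = 1%N \/ (2 <= u)%N by lia.
  + have [s0|[s1|s2]] : s = 0%N \/ s = 1%N \/ (2 <= s)%N by lia.
    * by nia.
    * by left; congr [:: _; _; _; _]; nia.
    * by nia.
  + by right; congr [:: _; _; _; _]; nia.
  + by nia.
- move=> /weight_degree[]; first by lia.
  move=> D W; have u0 : u = 0%N by nia.
  have [s0|[s1|s2]] : s = 0%N \/ s = 1%N \/ (2 <= s)%N by lia.
  + by right; congr [:: _; _; _; _]; nia.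
  + by left; congr [:: _; _; _; _]; nia.
  + by nia.
- move=> /weight_degree[]; first by lia.
  move=> D W.
  (* Replacing each variable weight e by t + 2 - e swaps x with w and y with z, which leads back to
     the previous case. *)
  have {}W : (t.+2 * p + t.+1 * q + s = t.+1)%N by nia.
  have p0 : p = 0%N by nia.
  have [q0|[q1|q2]] : q = 0%N \/ q = 1%N \/ (2 <= q)%N by lia.
  + by right; congr [:: _; _; _; _]; nia.
  + by left; congr [:: _; _; _; _]; nia.
  + by nia.
Qed.

End Example.

(** * The matrix and its rank *)

Definition col_of_seq (n : nat) (l : seq nat) : 'cV[int]_n :=
  \col_(j < n) (nth 0%N l j)%:Z.

Lemma col_of_seqE (n : nat) (l : seq nat) j :
  col_of_seq n l j 0 = (nth 0%N l j)%:Z.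
Proof. by rewrite mxE. Qed.

(** Row 0 is the weight, row 1 the total degree; row [i] beyond these reads off column [i.+2], past
    the four variables. *)
Definition example_entry (t i j : nat) : int :=
  if i == 0%N then
    (nth 0%N [:: shift t; (shift t).+1; (shift t + t.+1)%N; (shift t + t.+2)%N] j)%:Z
  else if i == 1%N then (if (j < 4)%N then 1 else 0) else (if j == i.+2 then 1 else 0).

Definition example_mx (t m n d : nat) : 'M[int]_(m, n) :=
  \matrix_(i < m, j < n) if (i < d)%N then example_entry t i j else 0.

Lemma row_pos_size t i : size (row_pos t i) = 4%N.
Proof. by rewrite /row_pos; do 2?case: ifP. Qed.

Lemma row_neg_size t i : size (row_neg t i) = 4%N.
Proof. by rewrite /row_neg; do 2?case: ifP. Qed.

Lemma example_mx_mul (t m n d : nat) (l : seq nat) (i : 'I_m) :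
  size l = 4%N ->
  (example_mx t m n.+4 d *m col_of_seq n.+4 l) i 0 =
  if (i < d)%N then
    if i == 0%N :> nat then (weight t l)%:Z
    else if i == 1%N :> nat then (sumn l)%:Z else 0
  else 0.
Proof.
case: l => [|x0 [|x1 [|x2 [|x3 [|? ?]]]]] // _.
rewrite mxE 4!big_ord_recl big1 ?addr0 => [|j _]; last by rewrite !mxE nth_default ?mulr0.
rewrite !mxE /= /example_entry; case: ifP => _; last by rewrite !mul0r !addr0.
by case: (val i) => [|[|k]] /=; rewrite /weight /bump /=; lia.
Qed.

Lemma example_mx_rank (t m n d : nat) :
  (1 <= d)%N -> (d <= n.+2)%N -> (d <= m)%N ->
  \rank (map_mx (intr : int -> rat) (example_mx t m n.+4 d)) = d.
Proof.
move=> d1 dn dm.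
(* [R] keeps the [d] possibly nonzero rows; their independence is to be shown. *)
pose R : 'M[rat]_(d, n.+4) := \matrix_(i, j) (example_entry t i j)%:~R.
have -> : map_mx (intr : int -> rat) (example_mx t m n.+4 d) = pid_mx d *m R.
  apply/matrixP => i j; rewrite !mxE; case: ifP => id.
    rewrite (bigD1 (Ordinal id)) //= big1 => [|k ki].
      by rewrite !mxE eqxx id mul1r addr0.
    rewrite !mxE; case: eqP => [ik|_]; last by rewrite mul0r.
    by case/eqP: ki; apply: val_inj.
  by rewrite big1 // => k _; rewrite !mxE id andbF mul0r.
rewrite mxrankMfree ?rank_pid_mx //; apply: inj_row_free => v vR.
have col (j : 'I_n.+4) : \sum_k v 0 k * (example_entry t k j)%:~R = 0.
  have /matrixP/(_ 0 j) := vR; rewrite !mxE => E; rewrite -[RHS]E.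
  by apply: eq_bigr => k _; rewrite !mxE.
have v2 (k : 'I_d) : (1 < k)%N -> v 0 k = 0.
  move=> k1; have kn : (k.+2 < n.+4)%N by have := ltn_ord k; lia.
  have := col (Ordinal kn); rewrite (bigD1 k) //= big1 => [|j jk].
    rewrite /example_entry; case: (val k) k1 => [|[|k']] //= _.
    by rewrite eqxx mulr1 addr0.
  rewrite /example_entry; case: eqP => _; first by rewrite nth_default ?mulr0 //; lia.
  case: eqP => _; first by rewrite ltnNge; case: (val k) k1 => [|[|]] //= *; rewrite mulr0.
  by rewrite !eqSS eq_sym (inj_eq val_inj) (negbTE jk) mulr0.
have v0 (k : 'I_d) : k = 0%N :> nat -> v 0 k = 0.
  (* Columns 1 and 0 differ by one in row 0 and agree in row 1. *)
  move=> k0; have : \sum_k v 0 k * (example_entry t k 1)%:~R -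
      \sum_k v 0 k * (example_entry t k 0)%:~R = 0.
    by rewrite (col (lift ord0 ord0)) (col ord0) subrr.
  rewrite -sumrB (bigD1 k) //= big1 => [|j jk].
    rewrite addr0 -mulrBr k0 /= -rmorphB /= => /eqP.
    rewrite mulf_eq0 => /orP[/eqP //|]; rewrite intr_eq0 /example_entry /=; lia.
  have [j1|j1] := leqP j 1; last by rewrite v2 // !mul0r subrr.
  suff -> : nat_of_ord j = 1%N by rewrite subrr.
  by apply/eqP; rewrite eqn_leq j1 lt0n -k0 (inj_eq val_inj).
apply/matrixP => i k; rewrite ord1 [RHS]mxE.
have [k1|] := ltnP 1 k; first exact: v2.
rewrite leq_eqVlt => /orP[/eqP k1|]; last by rewrite ltnS leqn0 => /eqP/v0.
have := col ord0; rewrite (bigD1 k) //= big1 => [|j jk].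
  by rewrite k1 /= mulr1 addr0.
have [j1|] := ltnP 1 j; first by rewrite v2 ?mul0r.
rewrite leq_eqVlt => /orP[/eqP j1|]; last by rewrite ltnS leqn0 => /eqP/v0 ->; rewrite mul0r.
by case/eqP: jk; apply: val_inj; rewrite /= j1 k1.
Qed.

(** * The two-point fiber in the lifting *)

Definition example_col (t n : nat) (row : nat -> seq nat) :
    'cV[int]_(\sum_(i < t.+2) n.+4) :=
  \mxcol_(i < t.+2) col_of_seq n.+4 (row i).

Lemma example_col_nneg t n row : nneg_col (example_col t n row).
Proof. by apply/nneg_col_blocks => i j; rewrite mxcolK col_of_seqE. Qed.

Lemma example_type t n :
  lawrence_type
    (example_col t n (row_pos t) - example_col t n (row_neg t)) = t.+2.
Proof.
rewrite /lawrence_type -[RHS]card_ord; apply: eq_card => i; rewrite !inE.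
(* The exponent of y differs in every pair. *)
apply/negP; rewrite submxcolB !mxcolK subr_eq0 => /eqP/matrixP/(_ (inord 1) 0).
by rewrite !col_of_seqE inordK // /row_pos /row_neg; do 2?case: ifP.
Qed.

Section ExampleFiber.

Variables t m n d : nat.
Hypotheses (t_gt0 : (0 < t)%N) (d_gt0 : (0 < d)%N) (d_le_m : (d <= m)%N).

Let A := example_mx t m n.+4 d.
Let w := example_col t n (row_pos t).
Let u := example_col t n (row_neg t).

Lemma example_ker :
  lawrence A t.+2 *m (w - u) = 0.
Proof.
apply/lawrence_kerE; split=> [i|].
  rewrite submxcolB !mxcolK mulmxBr; apply/eqP; rewrite subr_eq0; apply/eqP.
  apply/matrixP => k j; rewrite ord1 !example_mx_mul ?row_pos_size ?row_neg_size //.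
  do 3?case: ifP => _ //; congr Posz; rewrite /weight /row_pos /row_neg;
    do 2?case: ifP => _ //=; nia.
under eq_bigr do rewrite submxcolB !mxcolK.
rewrite !big_ord_recr /= /row_pos /row_neg !ltnn eqxx ltnNge leqnSn /= gtn_eqF //.
apply/matrixP => j k; rewrite ord1 !int_mxE int_summxE.
under eq_bigr => i _ do rewrite ltn_ord !int_mxE !col_of_seqE.
rewrite sumr_const card_ord !col_of_seqE.
by case: (val j) => [|[|[|[|j']]]] /=; rewrite ?nth_nil; lia.
Qed.

(** Each row has two choices by [row_fiber]; the column sums for x and w tie the choices
    together. *)
Lemma example_fiber (x : 'cV[int]_(\sum_(i < t.+2) n.+4)) :
  nneg_col x -> lawrence A t.+2 *m (w - x) = 0 ->
  x = w \/ x = u.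
Proof.
move=> /nneg_col_blocks x0 /lawrence_kerE[Ax sx].
have colx j : \sum_i submxcol x i j 0 =
    \sum_(i < t.+2) (nth 0%N (row_pos t i) j)%:Z.
  move: sx; under eq_bigr do rewrite submxcolB mxcolK.
  rewrite sumrB => /eqP; rewrite subr_eq0 => /eqP/matrixP/(_ j 0).
  rewrite !int_summxE => <-.
  by apply: eq_bigr => i _; rewrite col_of_seqE.
have x4 i (j : 'I_n.+4) : (4 <= j)%N -> submxcol x i j 0 = 0.
  move=> j4; apply: (sum_nneg_col_eq0 (F := fun i => submxcol x i)) => [k|].
    exact: x0.
  rewrite int_summxE colx big1 // => k _.
  by rewrite nth_default // row_pos_size.
have rowx i : submxcol x i = col_of_seq n.+4 (row_pos t i) \/
    submxcol x i = col_of_seq n.+4 (row_neg t i).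
  pose a k := absz (submxcol x i (inord k) 0).
  have xE : submxcol x i = col_of_seq n.+4 [:: a 0%N; a 1%N; a 2%N; a 3%N].
    apply/matrixP => j k; rewrite ord1 col_of_seqE.
    have [j4|j4] := leqP 4 j; first by rewrite x4 // nth_default.
    transitivity (a j)%:Z; last by case: (val j) j4 => [|[|[|[|]]]].
    by rewrite /a inord_val gez0_abs //; apply: x0.
  (* Row 0, the weight, is present since [d] is positive. *)
  have m0 : (0 < m)%N by apply: leq_trans d_le_m.
  have /matrixP/(_ (Ordinal m0) 0) := Ax i.
  rewrite submxcolB mxcolK mulmxBr !int_mxE xE !example_mx_mul ?row_pos_size //=.
  rewrite d_gt0 => /eqP; rewrite subr_eq0 => /eqP[] /esym/(row_fiber t_gt0).
  by case=> ->; [left|right].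
pose low (i : 'I_t) : 'I_t.+2 := widen_ord (leqnSn _) (widen_ord (leqnSn _) i).
pose mid : 'I_t.+2 := widen_ord (leqnSn _) ord_max.
have split_sum (F : 'I_t.+2 -> int) :
    \sum_i F i = \sum_(i < t) F (low i) + F mid + F ord_max.
  by rewrite !big_ord_recr.
have all_rows (row : nat -> seq nat) : (forall i, submxcol x (low i) = col_of_seq n.+4 (row i)) ->
    submxcol x mid = col_of_seq n.+4 (row t) ->
    submxcol x ord_max = col_of_seq n.+4 (row t.+1) -> x = example_col t n row.
  move=> xl xm xM; apply/mxcolP => i; rewrite mxcolK.
  have [it|] := ltnP i t.
    by rewrite (_ : i = low (Ordinal it)) ?xl //; apply: val_inj.
  rewrite leq_eqVlt => /orP[/eqP ti|ti].
    by rewrite (_ : i = mid) ?xm //; apply: val_inj.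
  by rewrite (_ : i = ord_max) ?xM //; apply: val_inj => /=; have := ltn_ord i; lia.
have rpl i : (i < t)%N -> row_pos t i = [:: 0; 1; 1; 0]%N by rewrite /row_pos => ->.
have rnl i : (i < t)%N -> row_neg t i = [:: 1; 0; 0; 1]%N by rewrite /row_neg => ->.
have rpm : row_pos t t = [:: t; 0; 1; 0]%N by rewrite /row_pos ltnn eqxx.
have rnm : row_neg t t = [:: 0; t.+1; 0; 0]%N by rewrite /row_neg ltnn eqxx.
have rpM : row_pos t t.+1 = [:: 0; 1; 0; t]%N.
  by rewrite /row_pos ltnNge leqnSn gtn_eqF.
have rnM : row_neg t t.+1 = [:: 0; 0; t.+1; 0]%N.
  by rewrite /row_neg ltnNge leqnSn gtn_eqF.
pose j3 : 'I_n.+4 := inord 3; have j3E : j3 = 3%N :> nat by rewrite inordK.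
(* [y i] is 0 or 1 according to the choice in row [i], where it is the exponent of both x and w. *)
pose y i := submxcol x (low i) ord0 0.
have yx i : submxcol x (low i) j3 0 = y i.
  by rewrite /y; case: (rowx (low i)) => ->; rewrite !col_of_seqE j3E ?rpl ?rnl /=.
have y01 i : 0 <= y i <= 1.
  by rewrite /y; case: (rowx (low i)) => ->; rewrite col_of_seqE ?rpl ?rnl /=.
have ypos i : y i = 0 -> submxcol x (low i) = col_of_seq n.+4 (row_pos t i).
  by rewrite /y; case: (rowx (low i)) => // ->; rewrite col_of_seqE rnl /=.
have yneg i : y i = 1 -> submxcol x (low i) = col_of_seq n.+4 (row_neg t i).
  by rewrite /y; case: (rowx (low i)) => // ->; rewrite col_of_seqE rpl /=.
(* In the x column the middle row contributes t or 0, which forces all [y i] to be 0 or all to be 1;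
   the w column then fixes the last row. *)
have sum0 : \sum_i y i + submxcol x mid ord0 0 = t%:Z.
  have := colx ord0; rewrite !split_sum /= rpm rpM [X in _ = X + _ + _]big1 => [|i _].
    have -> : submxcol x ord_max ord0 0 = 0.
      by case: (rowx ord_max) => ->; rewrite col_of_seqE ?rpM ?rnM.
    by rewrite !addr0 add0r.
  by rewrite rpl.
have sum3 : \sum_i y i + submxcol x ord_max j3 0 = t%:Z.
  have := colx j3; rewrite !split_sum /= rpm rpM j3E /= [X in _ = X + _ + _]big1 => [|i _].
    have -> : submxcol x mid j3 0 = 0.
      by case: (rowx mid) => ->; rewrite col_of_seqE j3E ?rpm ?rnm.
    by under eq_bigr do rewrite yx; rewrite !addr0 add0r.
  by rewrite rpl.
case: (rowx mid) => xm.
- left; have y0 : \sum_i y i = 0.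
    by move: sum0; rewrite xm col_of_seqE rpm /= => /eqP; rewrite -subr_eq0 addrK => /eqP.
  apply: all_rows => // [i|].
    apply: ypos; apply/eqP; move/eqP: y0; rewrite psumr_eq0 => [/allP/(_ i)|k _].
      by apply; rewrite mem_index_enum.
    by case/andP: (y01 k).
  case: (rowx ord_max) => // xM; move: sum3.
  rewrite y0 xM col_of_seqE /= rnM j3E /=; lia.
- right; have y1 : \sum_i (1 - y i) = 0.
    move: sum0; rewrite xm col_of_seqE rnm /= addr0 => y0.
    by rewrite sumrB y0 sumr_const card_ord natz subrr.
  apply: all_rows => // [i|].
    apply: yneg; apply/eqP; rewrite eq_sym -subr_eq0.
    move/eqP: y1; rewrite psumr_eq0 => [/allP/(_ i)|k _].
      by apply; rewrite mem_index_enum.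
    by rewrite subr_ge0; case/andP: (y01 k).
  case: (rowx ord_max) => // xM; move: sum3 sum0.
  rewrite xM xm !col_of_seqE /= rpM rnm j3E /= => sum3 sum0; lia.
Qed.

End ExampleFiber.

(** * Arbitrarily large complexity *)

Lemma lawrence_typeN (r n : nat) (v : 'cV[int]_(\sum_(i < r) n)) :
  lawrence_type (- v) = lawrence_type v.
Proof. by apply: eq_card => i; rewrite !inE submxcolN oppr_eq0. Qed.

Theorem theorem6p1 (n d m : nat) (hn : (4 <= n)%N) (hd1 : (1 <= d)%N)
    (hd2 : (d <= n - 2)%N) (hm : (d <= m)%N) (N : nat) (hN : (0 < N)%N) :
  exists A : 'M[int]_(m, n),
    \rank (map_mx (intr : int -> rat) A) = d /\
    exists2 k : nat, is_markov_complexity A k & (N <= k)%N.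
Proof.
case: n hn hd2 => [|[|[|[|n]]]] // _ hd2.
(* The parameter t is [N], positive by [hN]; the element then has type [N.+2]. *)
exists (example_mx N m n.+4 d); split.
  by apply: example_mx_rank => //; move: hd2; rewrite !subSS subn0.
set A := example_mx _ _ _ _.
set w := example_col N n (row_pos N); set u := example_col N n (row_neg N).
have type_wu : lawrence_type (w - u) = N.+2 by apply: example_type.
suff [v vU vt] : exists2 v, universal_markov_basis (lawrence A N.+2) v
    & lawrence_type v = N.+2.
  have [//|k kA vk] := exists_markov_complexity _ vU.
  by exists k => //; apply: leq_trans vk; rewrite vt; lia.
have [S Smin] := exists_minimal_markov_basis (lawrence A N.+2).
have wu : w <> u.
  move=> E; move: type_wu; rewrite E subrr /lawrence_type eq_card0 // => i.
  by rewrite !inE submxcol0 eqxx.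
(* Membership holds up to sign, which does not affect the type. *)
have [wuS|uwS] : w - u \in S \/ u - w \in S.
  apply: (indispensable_in_markov_basis Smin.1) => //.
  - exact: example_col_nneg.
  - exact: example_col_nneg.
  - exact: example_ker.
  - by move=> x; apply: example_fiber.
- by exists (w - u) => //; exists S.
- by exists (u - w); [exists S|rewrite -opprB lawrence_typeN].
Qed.
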